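(* Let $R>1$, $k\ge 0$ and $1\le c_2<c_1\le R$, and let $E_a(c_2,c_1)$ be the strain energy of the punctured region $\Omega_a(c_2,c_1)$ described in the context. Then $$\lim_{a\to0}\Big|E_a(c_2,c_1)-\frac{2k}{a}(c_1-c_2)\Big|=0,$$ so that $E_a(c_2,c_1)=O(a^{-1})$ as $a\to 0$. In particular, for the whole region $\Omega$, $$\lim_{a\to0}\Big|E_a(1,R)-\frac{2k}{a}(R-1)\Big|=0,$$ and when $k=0$ the strain energy has no singularity and vanishes in the limit $a\to0$.
   Context: Fix $R>1$ and a constant $k\ge0$. For $1\le c_2<c_1\le R$, $\Omega(c_2,c_1)\subset\mathbb{R}^2$ is the region bounded internally by the circle of radius $c_2$ centred at $(c_2,0)$ and externally by the circle of radius $c_1$ centred at $(c_1,0)$ (the circles touch at the origin); $\Omega=\Omega(1,R)$. For small $a>0$, $\Omega_a(c_2,c_1)=\Omega(c_2,c_1)\setminus B(0,a)$, where $B(0,a)$ is the closed ball of radius $a$ about the origin. Polar coordinates $(r,\theta)$ are based at the origin, $x_1=r\cos\theta$, $x_2=r\sin\theta$, $-\pi/2<\theta<\pi/2$ on $\Omega\setminus\{(0,0)\}$. The displacement is $u_1=x_2$, $u_2=\frac{x_2^2-x_1^2}{2x_1}$, with linear strains $e_{\alpha\beta}=\frac12(u_{\alpha,\beta}+u_{\beta,\alpha})$, i.e. $$e_{11}=0,\qquad e_{22}=\tan\theta,\qquad e_{12}=e_{21}=\frac{\cos2\theta}{4\cos^2\theta},$$ and the stresses are $$\sigma_{11}=-2\Big[2\theta+\frac{r^2+k}{r^2}\sin2\theta\Big],\quad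 \sigma_{22}=2\Big[-2\theta+\frac{r^2+k}{r^2}\sin2\theta\Big],\quad \sigma_{12}=\sigma_{21}=2\,\frac{r^2+k}{r^2}\cos2\theta.$$ The strain energy $E_a(c_2,c_1)$ is defined by $$2E_a(c_2,c_1)=\int_{\Omega_a(c_2,c_1)}\sigma_{\alpha\beta}e_{\alpha\beta}\,dx_1\,dx_2,$$ with summation over $\alpha,\beta\in\{1,2\}$. *)

(* Defs.v *)
From HB Require Import structures.
From mathcomp Require Import all_boot all_order all_algebra.
From mathcomp Require Import all_classical all_reals all_analysis.
From mathcomp Require Import ring lra.

Set Implicit Arguments.
Unset Strict Implicit.
Unset Printing Implicit Defensive.

Import Order.TTheory GRing.Theory Num.Theory.
Import numFieldNormedType.Exports.

Local Open Scope classical_set_scope.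
Local Open Scope ring_scope.

Section StrainEnergy.
Context {R : realType}.
Implicit Types (x p : R * R) (a c k : R).

(* The library's norm on R * R is the sup norm, hence an explicit Euclidean
   norm. *)
Definition enorm x : R := Num.sqrt (x.1 ^+ 2 + x.2 ^+ 2).

Definition eclosed_ball p c : set (R * R) := [set x | enorm (x - p) <= c].

(* The closed region between the two circles: it contains the contact point
   (0, 0), and x.1 > 0 at all its other points. *)
Definition Omega c2 c1 : set (R * R) :=
  [set x | c2 <= enorm (x - (c2, 0)) /\ enorm (x - (c1, 0)) <= c1].

Definition Omega_a c2 c1 a : set (R * R) :=
  Omega c2 c1 `\` eclosed_ball (0, 0) a.

Definition polar_r x : R := enorm x.

(* The polar angle in ]-pi/2, pi/2[ of a point of the half plane x.1 > 0;
   see polarP. *)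
Definition polar_theta x : R := atan (x.2 / x.1).

(* In vectors and matrices, the indices 1, 2 of the coordinates are
   (0 : 'I_2), (1 : 'I_2). *)
Definition displacement x : 'rV[R]_2 :=
  \row_i (if i == 0 then x.2 else (x.2 ^+ 2 - x.1 ^+ 2) / (2 * x.1)).

Definition partial (f : R * R -> R) (j : 'I_2) x : R :=
  if j == 0 then derive1 (fun t => f (t, x.2)) x.1
  else derive1 (fun t => f (x.1, t)) x.2.

Definition strain x : 'M[R]_2 :=
  \matrix_(i, j) (2^-1 * (partial (fun y => displacement y 0 i) j x
                          + partial (fun y => displacement y 0 j) i x)).

Definition stress k x : 'M[R]_2 :=
  let r := polar_r x in
  let t := polar_theta x in
  let q := (r ^+ 2 + k) / r ^+ 2 in
  \matrix_(i, j)
    (if i != j then 2 * (q * cos (2 * t))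
     else if i == 0 then - 2 * (2 * t + q * sin (2 * t))
     else 2 * (- (2 * t) + q * sin (2 * t))).

Definition energy_density k x : R :=
  \sum_i \sum_j stress k x i j * strain x i j.

(* measurableTypeR R is R with the Borel sets, the carrier on which
   lebesgue_measure is declared as a measure. *)
Definition area :
    {measure set (measurableTypeR R * measurableTypeR R) -> \bar R} :=
  (@lebesgue_measure R \x @lebesgue_measure R)%E.

Definition strain_energy k c2 c1 a : R :=
  2^-1 * \int[area]_(x in Omega_a c2 c1 a) energy_density k x.

Lemma polarP x : 0 < x.1 ->
  [/\ x.1 = polar_r x * cos (polar_theta x),
      x.2 = polar_r x * sin (polar_theta x)
    & - (pi / 2) < polar_theta x < pi / 2].
Proof.
case: x => x1 x2 /= x1_gt0; rewrite /polar_r /polar_theta /enorm /=.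
have t_itv : - (pi / 2) < atan (x2 / x1) < pi / 2.
  by rewrite atan_gtNpi2 atan_ltpi2.
have cos_gt0 : 0 < cos (atan (x2 / x1)) by exact: cos_gt0_pihalf.
have cosE : x1 = Num.sqrt (x1 ^+ 2 + x2 ^+ 2) * cos (atan (x2 / x1)).
  have -> : x1 ^+ 2 + x2 ^+ 2 = x1 ^+ 2 * (1 + (x2 / x1) ^+ 2).
    by field; rewrite gt_eqF.
  rewrite sqrtrM ?sqr_ge0// sqrtr_sqr gtr0_norm// cos_atan mulfK// gt_eqF//.
  by rewrite sqrtr_gt0 ltr_wpDr ?sqr_ge0.
split=> //.
have tE := atanK (x2 / x1).
rewrite /tan in tE.
have -> : sin (atan (x2 / x1)) = x2 / x1 * cos (atan (x2 / x1)).
  by move: tE cos_gt0; set t := atan _ => <- ct0; rewrite divfK// gt_eqF.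
by rewrite mulrCA -cosE divfK// gt_eqF.
Qed.

Let derive1_u2_x1 a (b : R) : a != 0 ->
  derive1 (fun y : R => (b ^+ 2 - y ^+ 2) / (2 * y)) a = - (1 + (b / a) ^+ 2) / 2.
Proof.
move=> a0.
have fE : (fun y : R => (b ^+ 2 - y ^+ 2) / (2 * y)) =
    (cst (b ^+ 2) - (fun y : R => y) ^+ 2) * (cst 2^-1 * (fun y : R => y^-1)).
  by apply/funext => y; rewrite invfM.
have h : is_derive a 1
    ((cst (b ^+ 2) - (fun y : R => y) ^+ 2) * (cst 2^-1 * (fun y : R => y^-1)))
    (- (1 + (b / a) ^+ 2) / 2).
  have hv : is_derive a 1 (fun y : R => y^-1) (- a ^- 2).
    apply: DeriveDef; first exact: (@derivableV _ _ id).
    rewrite (@deriveV _ _ id)//.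
    by rewrite derive_id /GRing.scale/= mulr1.
  apply: is_derive_eq.
  rewrite /GRing.scale/= !fctE /cst; by field.
by rewrite fE derive1E (@derive_val _ _ _ _ _ _ _ h).
Qed.

Let derive1_u2_x2 a (b : R) : a != 0 ->
  derive1 (fun y : R => (y ^+ 2 - a ^+ 2) / (2 * a)) b = b / a.
Proof.
move=> a0.
have fE : (fun y : R => (y ^+ 2 - a ^+ 2) / (2 * a)) =
    (fun y : R => y) ^+ 2 * cst (2 * a)^-1 - cst (a ^+ 2 / (2 * a)).
  by apply/funext => y; rewrite mulrBl.
have h : is_derive b 1
    ((fun y : R => y) ^+ 2 * cst (2 * a)^-1 - cst (a ^+ 2 / (2 * a))) (b / a).
  apply: is_derive_eq.
  rewrite /GRing.scale/= /cst; by field.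
by rewrite fE derive1E (@derive_val _ _ _ _ _ _ _ h).
Qed.

Lemma strainE x : 0 < x.1 ->
  let t := polar_theta x in
  [/\ strain x 0 0 = 0, strain x 1 1 = tan t,
      strain x 0 1 = cos (2 * t) / (4 * cos t ^+ 2)
    & strain x 1 0 = cos (2 * t) / (4 * cos t ^+ 2)].
Proof.
move=> x1_gt0 t; have [_ _ t_itv] := polarP x1_gt0.
have c0 : cos t != 0 by rewrite gt_eqF// cos_gt0_pihalf.
have x10 : x.1 != 0 by rewrite gt_eqF.
have tE : tan t = x.2 / x.1 by rewrite atanK.
have d1 := derive1_u2_x1 x.2 x10; have d2 := derive1_u2_x2 x.2 x10.
have e01 : 2^-1 * (1 + - (1 + tan t ^+ 2) / 2) = cos (2 * t) / (4 * cos t ^+ 2).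
  rewrite -cos2_tan2// mulr_natl cos_mulr2n.
  by field.
rewrite -e01 tE; split; rewrite !mxE /partial /displacement /=.
- by under eq_fun do rewrite mxE/=; rewrite derive1_cst addr0 mulr0.
- under eq_fun do rewrite mxE/=; rewrite d2.
  by rewrite -mulr2n -[X in 2^-1 * X]mulr_natl mulKf// pnatr_eq0.
- under eq_fun do rewrite mxE/=; under [X in _ + derive1 X _]eq_fun do rewrite mxE/=.
  by rewrite derive1_id d1.
- under eq_fun do rewrite mxE/=; under [X in _ + derive1 X _]eq_fun do rewrite mxE/=.
  by rewrite derive1_id d1 addrC.
Qed.

End StrainEnergy.

(* Main.v *)
Require Import Defs.
From HB Require Import structures.
From mathcomp Require Import all_boot all_order all_algebra.
From mathcomp Require Import all_classical all_reals all_analysis.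
From mathcomp Require Import measurable_realfun ring lra.

Set Implicit Arguments.
Unset Strict Implicit.
Unset Printing Implicit Defensive.

Import Order.TTheory GRing.Theory Num.Theory.
Import numFieldNormedType.Exports.

Local Open Scope classical_set_scope.
Local Open Scope ring_scope.

(** The strain energy is computed in closed form, up to an error of order [a].

    In Cartesian form the energy density at [(x, y)] is
    [slope_weight (y / x) + k / x ^+ 2] ([energy_densityE]), so that it depends
    on [x] and on the slope [t = y / x] only.  In the coordinates [(x, t)],
    whose Jacobian is [x] ([integral_slope_iterated]), the disc of radius [c]
    centred at [(c, 0)] minus the ball of radius [a] about the origin is cut by
    each line of slope [t] in the interval of endpoints
    [a / sqrt (1 + t ^+ 2)] and [2 * c / (1 + t ^+ 2)], which is nonempty iff
    [t] lies strictly between [- T] and [T], with [T = sqrt ((2c/a)^2 - 1)]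
    ([disc_slope]).  The punctured crescent being the difference of two such
    truncated discs ([Omega_a_setU]), each disc can be treated alone.

    Integrating in [x] leaves an integral over the slopes in [- T, T].  It
    splits into [slice_main], which has the elementary primitive
    [slice_primitive], and [a ^+ 2 / 2] times a bounded function.  Since [a * T]
    stays bounded by [2 * c], the latter contributes [O(a)], and the former is
    [a ^+ 2 * (2 * atan T - T) + 2 * k * (T - atan T)], where the [k]-free part
    is again [O(a)]: the odd primitive [(2 * atan t - t) / (1 + t ^+ 2)] of
    [slope_weight t / (1 + t ^+ 2) ^+ 2] vanishes at infinity, which is why no
    energy is left in the limit when [k = 0].  As [T = 2c/a + O(a)]
    and [atan T] tends to [pi / 2], the integral of the density over the
    truncated disc is [4 * k * c / a - k * pi + o(1)] ([cvg_disc_energy]).  The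
    constant [- k * pi] does not depend on [c], hence cancels in the difference
    of the two discs, and halving gives the theorem. *)

(** * The coordinates (x, y / x) *)

Section SlopeCoordinates.
Context {R : realType}.
Local Open Scope ereal_scope.

Local Notation mu := (@lebesgue_measure R).

Lemma measurable_invr : measurable_fun setT (@GRing.inv R).
Proof.
rewrite -(setUv [set 0%R]); apply/measurable_funU => //; first exact: measurableC.
split; first exact: measurable_fun_set1.
apply: open_continuous_measurable_fun; first exact/closed_openC/closed_eq.
by move=> x /[!inE]/= /eqP x0; exact: inv_continuous.
Qed.

(** The codomain annotation selects the Borel structure on which
    [lebesgue_measure] lives, so that [pushforward mu (dil c)] is recognized as
    a measure. *)
Let dil (c t : R) : measurableTypeR R := (c * t)%R.

Let measurable_dil c : measurable_fun setT (dil c : measurableTypeR R -> _).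
Proof. exact: mulrl_measurable. Qed.

(** By uniqueness of Lebesgue measure it suffices to compare the two measures
    on bounded intervals. *)
Lemma lebesgue_measureZ (c : R) (A : set R) : (0 < c)%R -> measurable A ->
  mu A = c%:E * pushforward mu (fun t => c * t : measurableTypeR R)%R A.
Proof.
move=> c0 mA; rewrite -/(dil c).
pose nu := (mscale (NngNum (ltW c0)) (pushforward mu (dil c))
  : {measure set (measurableTypeR R) -> \bar R}).
rewrite (@lebesgue_measure_unique _ (nu (@measurable_dil c)))// => _ [[a b]] _ <-.
transitivity (c%:E * mu [set` `]a / c, b / c]%R]); last first.
  rewrite /nu/= /mscale/= /pushforward; congr (_ * mu _).
  apply/seteqP; split=> t /=; rewrite !in_itv/= ltr_pdivrMr// ler_pdivlMr//;
    by rewrite /dil mulrC.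
rewrite !lebesgue_measure_itv/= !lte_fin ltr_pM2r ?invr_gt0//.
case: ifP => _; last by rewrite mule0.
by rewrite -!EFinB -EFinM; congr EFin; field; rewrite gt_eqF.
Qed.

Lemma ge0_integral_dilation (c : R) (f : R -> \bar R) : (0 < c)%R ->
  measurable_fun setT f -> (forall y, 0 <= f y) ->
  \int[mu]_y f y = \int[mu]_t (c%:E * f (c * t)%R).
Proof.
move=> c0 mf f0.
pose nu := (pushforward mu (dil c) : {measure set (measurableTypeR R) -> \bar R}).
rewrite (@eq_measure_integral _ _ _ _
  (mscale (NngNum (ltW c0)) (nu (@measurable_dil c)))); last first.
  by move=> A mA _; exact: lebesgue_measureZ.
rewrite ge0_integral_mscale// ge0_integral_pushforward//.
rewrite preimage_setT ge0_integralZl//; last by rewrite lee_fin ltW.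
by apply: (measurableT_comp mf); exact: measurable_dil.
Qed.

(** Change of variables [(x, y) = (x, x * t)]: by Tonelli this reduces, for each
    fixed [x > 0], to the dilation [y = x * t] of the line.  The integrand has to
    vanish for [x <= 0], where [x] is not the absolute value of a nonzero
    Jacobian. *)
Lemma ge0_integral_slope (f : R * R -> \bar R) :
  measurable_fun setT (f : measurableTypeR R * measurableTypeR R -> _) ->
  (forall z, 0 <= f z) ->
  (forall z, (z.1 <= 0)%R -> f z = 0) ->
  \int[area]_z f z = \int[area]_z (z.1%:E * f (z.1, z.1 * z.2)%R).
Proof.
move=> mf f0 fN.
have mg : measurable_fun setT (fun z : measurableTypeR R * measurableTypeR R =>
    z.1%:E * f (z.1, z.1 * z.2)%R).
  apply: emeasurable_funM; first exact/measurable_EFinP.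
  apply: (measurableT_comp mf); apply: measurable_fun_pair => //=.
  exact: measurable_funM.
have g0 z : 0 <= z.1%:E * f (z.1, z.1 * z.2)%R.
  have [z0|z0] := leP z.1 0%R; first by rewrite fN// mule0.
  by rewrite mule_ge0// lee_fin ltW.
rewrite /area !fubini_tonelli1//.
apply: eq_integral => x _; rewrite /fubini_F/=.
have [x0|x0] := leP x 0%R.
  by under eq_integral do rewrite fN//;
     under [RHS]eq_integral do rewrite fN// mule0.
rewrite (@ge0_integral_dilation x (fun y => f (x, y)))//.
exact: measurableT_comp.
Qed.

(** Positive and negative parts commute
    with multiplication by the Jacobian, which is positive where [f] is not
    zero. *)
Lemma integral_slope (f : R * R -> \bar R) :
  measurable_fun setT (f : measurableTypeR R * measurableTypeR R -> _) ->
  (forall z, (z.1 <= 0)%R -> f z = 0) ->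
  \int[area]_z f z = \int[area]_z (z.1%:E * f (z.1, z.1 * z.2)%R).
Proof.
move=> mf fN; rewrite integralE [RHS]integralE.
congr (_ - _).
- rewrite ge0_integral_slope//.
  + apply: eq_integral => -[x y] _ /=; rewrite !funeposE/=.
    have [x0|x0] := leP x 0%R; first by rewrite fN// maxxx mule0 maxxx.
    by rewrite maxe_pMr ?mule0// lee_fin ltW.
  + exact: measurable_funepos.
  + by move=> z z0; rewrite funeposE fN// maxxx.
- rewrite ge0_integral_slope//.
  + apply: eq_integral => -[x y] _ /=; rewrite !funenegE/=.
    have [x0|x0] := leP x 0%R; first by rewrite fN// mule0 oppe0 maxxx mule0.
    by rewrite maxe_pMr ?mule0 ?muleN// lee_fin ltW.
  + exact: measurable_funeneg.
  + by move=> z z0; rewrite funenegE fN// oppe0 maxxx.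
Qed.

(** Integrability passes to the new coordinates by the nonnegative case applied
    to [abse \o f]; Fubini then puts the slope outside. *)
Lemma integral_slope_iterated (f : R * R -> \bar R) :
  area.-integrable setT f ->
  (forall z, (z.1 <= 0)%R -> f z = 0) ->
  \int[area]_z f z = \int[mu]_t \int[mu]_x (x%:E * f (x, x * t)%R).
Proof.
move=> intf fN; have mf := measurable_int area intf.
rewrite integral_slope//.
suff intg : (mu \x mu).-integrable setT
    (fun z : measurableTypeR R * measurableTypeR R =>
      z.1%:E * f (z.1, z.1 * z.2)%R).
  by rewrite -(integral21_prod_meas1 intg).
apply/integrableP; split.
  apply: emeasurable_funM; first exact/measurable_EFinP.
  apply: (measurableT_comp mf); apply: measurable_fun_pair => //=.
  exact: measurable_funM.
move/integrableP : intf => [_]; rewrite ge0_integral_slope//.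
- under eq_integral => z _.
    rewrite (_ : _ * _ = `|z.1%:E * f (z.1, (z.1 * z.2)%R)|); first over.
    have [z0|z0] := leP z.1 0%R; first by rewrite fN// !(mule0, abse0).
    by rewrite abseM [X in _ = X * _]gee0_abs// lee_fin ltW.
  by [].
- exact: measurableT_comp.
- by move=> z z0; rewrite fN// abse0.
Qed.

End SlopeCoordinates.

(** * The energy density in terms of the slope *)

Section EnergyDensity.
Context {R : realType}.
Implicit Types (k t : R) (z : R * R).

(** The energy density for [k = 0]; with [t = tan theta] it is the combination
    [sec^2 theta - 4 theta tan theta]. *)
Definition slope_weight t : R := 1 + t ^+ 2 - 4 * t * atan t.

Definition slope_density k z : R := slope_weight (z.2 / z.1) + k / z.1 ^+ 2.

(** The shear and normal contributions of [q = (r ^+ 2 + k) / r ^+ 2] add up to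
    [q * (cos^2 (2 theta) + sin^2 (2 theta)) / cos^2 theta = q / cos^2 theta], and
    [r cos theta] is the first coordinate. *)
Lemma energy_densityE k z : 0 < z.1 -> energy_density k z = slope_density k z.
Proof.
move=> z1_gt0; have [xE yE t_itv] := polarP z1_gt0.
have [e00 e11 e01 e10] := strainE z1_gt0.
have sum2 (F : 'I_2 -> R) : \sum_i F i = F 0 + F 1.
  by rewrite big_ord_recl big_ord1; congr (_ + F _); exact/val_inj.
rewrite /energy_density !sum2 e00 e01 e10 e11 !mxE /=.
rewrite /slope_density /slope_weight -/(polar_theta z).
have tE : tan (polar_theta z) = z.2 / z.1 by rewrite /polar_theta atanK.
rewrite -tE xE /tan.
set t := polar_theta z in xE yE t_itv tE *; set r := polar_r z in xE yE *.
have c0 : cos t != 0 by rewrite gt_eqF// cos_gt0_pihalf.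
have r0 : r != 0 by apply: contraTneq z1_gt0 => r0; rewrite xE r0 mul0r ltxx.
have s2 : sin t ^+ 2 = 1 - cos t ^+ 2 by rewrite sin2cos2.
have -> : 2 * t = t *+ 2 by rewrite mulr_natl.
rewrite sin_mulr2n cos_mulr2n -mulr_natl.
set s := sin t in s2 *; set c := cos t in c0 s2 *.
rewrite mulr0 add0r.
have -> : 1 + (s / c) ^+ 2 = c ^- 2 by rewrite expr_div_n s2; field.
have -> : (c ^+ 2 *+ 2 - 1) = 2 * c ^+ 2 - 1 by rewrite mulr_natl.
(* The two sides are not equal as rational functions of [s] and [c]: their
   difference is an explicit multiple of [s ^+ 2 - (1 - c ^+ 2)]. *)
apply/eqP; rewrite -subr_eq0; apply/eqP.
transitivity ((r ^+ 2 + k) / (r * c) ^+ 2 *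
   (4 * c ^+ 2 * (s ^+ 2 - (1 - c ^+ 2)))); last by rewrite s2 subrr !mulr0.
by field; rewrite c0 r0.
Qed.

Lemma measurable_slope_density k :
  measurable_fun setT (slope_density k : measurableTypeR R * measurableTypeR R -> R).
Proof.
have mV : measurable_fun setT
    (fun z : measurableTypeR R * measurableTypeR R => z.1^-1 : R).
  exact: (measurableT_comp measurable_invr).
have mT : measurable_fun setT
    (fun z : measurableTypeR R * measurableTypeR R => z.2 / z.1 : R).
  exact: measurable_funM.
have mW : measurable_fun setT (slope_weight : R -> R).
  apply: measurable_funB; first by apply: measurable_funD => //; exact: measurable_funX.
  apply: measurable_funM; first exact: mulrl_measurable.
  by apply: continuous_measurable_fun => x; exact: continuous_atan.
apply: measurable_funD; first exact: (measurableT_comp mW).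
under eq_fun do rewrite -exprVn.
by apply: measurable_funM => //; exact: measurable_funX.
Qed.

End EnergyDensity.

(** * Discs through the origin, truncated near the origin *)

Section TruncatedDisc.
Context {R : realType}.
Implicit Types (b : bool) (a c k t x : R) (z : R * R).

(** The disc of radius [c] centred at [(c, 0)], closed if [b] and open otherwise,
    minus the closed ball of radius [a] about the origin.  Both versions occur:
    the crescent is the closed outer disc minus the open inner one. *)
Definition truncated_disc b c a : set (R * R) :=
  [set z | (z.1 ^+ 2 + z.2 ^+ 2 < 2 * c * z.1 ?<= if b) /\
           a ^+ 2 < z.1 ^+ 2 + z.2 ^+ 2].

Lemma enorm_le z r : 0 <= r -> (enorm z <= r) = (z.1 ^+ 2 + z.2 ^+ 2 <= r ^+ 2).
Proof.
move=> r0; rewrite /enorm -(@ler_pXn2r _ 2)// ?nnegrE ?sqrtr_ge0//.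
by rewrite sqr_sqrtr// addr_ge0// sqr_ge0.
Qed.

Lemma Omega_a_setU c2 c1 a : 0 <= a -> 0 < c2 -> c2 < c1 ->
  Omega_a c2 c1 a `|` truncated_disc false c2 a = truncated_disc true c1 a.
Proof.
move=> a0 c20 c21; have c10 := lt_trans c20 c21.
apply/seteqP; split=> -[x y]; rewrite /truncated_disc /Omega_a /Omega /eclosed_ball/=.
- move=> [[[_ h1] /negP h2]|[h1 h2]].
    move: h1 h2; rewrite !enorm_le ?(ltW c10)//= !subr0 -ltNge => h1 h2.
    by split=> //; lra.
  split=> //; have x0 : 0 < x by have := sqr_ge0 a; nra.
  nra.
- move=> [h1 h2]; have x0 : 0 < x by have := sqr_ge0 a; nra.
  have [h3|h3] := ltP (x ^+ 2 + y ^+ 2) (2 * c2 * x); first by right.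
  left; split; last by rewrite enorm_le//= !subr0; apply/negP; rewrite -ltNge.
  split; last by rewrite enorm_le ?(ltW c10)//= subr0; lra.
  rewrite /enorm -[leLHS](@ger0_norm _ c2) ?(ltW c20)// -sqrtr_sqr.
  rewrite ler_sqrt ?addr_ge0 ?sqr_ge0//=.
  by rewrite subr0; lra.
Qed.

Lemma Omega_a_disj c2 c1 a : 0 < c2 ->
  [disjoint Omega_a c2 c1 a & truncated_disc false c2 a].
Proof.
move=> c20; rewrite disj_set2E; apply/eqP; rewrite -subset0 => -[x y] /=.
rewrite /truncated_disc /Omega_a /Omega /eclosed_ball/= => -[[[h _] _] [h1 _]].
have /negP[] : ~~ (enorm ((x, y) - (c2, 0)) < c2) by rewrite -leNgt.
rewrite /enorm -[ltRHS](@ger0_norm _ c2) ?(ltW c20)// -sqrtr_sqr ltr_sqrt ?exprn_gt0//=.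
by rewrite subr0; lra.
Qed.

Lemma measurable_truncated_disc b c a :
  measurable (truncated_disc b c a : set (measurableTypeR R * measurableTypeR R)).
Proof.
pose n2 := fun z : measurableTypeR R * measurableTypeR R => z.1 ^+ 2 + z.2 ^+ 2 : R.
have mn2 : measurable_fun setT n2 by apply: measurable_funD; exact: measurable_funX.
have ml : measurable_fun setT
    (fun z : measurableTypeR R * measurableTypeR R => 2 * c * z.1 : R).
  exact: measurable_funM.
rewrite (_ : truncated_disc b c a = setT `&`
  (fun z : measurableTypeR R * measurableTypeR R =>
    (n2 z < 2 * c * z.1 ?<= if b) && (a ^+ 2 < n2 z)) @^-1` [set true]).
  have m : measurable_fun setT (fun z : measurableTypeR R * measurableTypeR R =>
      (n2 z < 2 * c * z.1 ?<= if b) && (a ^+ 2 < n2 z)).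
    apply: measurable_and; last exact: measurable_fun_ltr.
    by case: b => /=; [exact: measurable_fun_ler|exact: measurable_fun_ltr].
  exact: m.
by rewrite setTI; apply/seteqP; split=> z /=; [move=> [-> ->]|move/andP].
Qed.

Lemma measurable_Omega_a c2 c1 a : 0 <= a -> 0 < c2 -> c2 < c1 ->
  measurable (Omega_a c2 c1 a : set (measurableTypeR R * measurableTypeR R)).
Proof.
move=> a0 c20 c21.
rewrite (_ : Omega_a c2 c1 a =
    truncated_disc true c1 a `\` truncated_disc false c2 a); last first.
  rewrite -(@Omega_a_setU c2)// setUDK//.
  by rewrite setIC; apply/disj_setPS; exact: Omega_a_disj.
by apply: measurableD; exact: measurable_truncated_disc.
Qed.

Lemma truncated_disc_bound b c a z : 0 < a -> 0 < c -> truncated_disc b c a z ->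
  [/\ a ^+ 2 / (2 * c) <= z.1, z.1 <= 2 * c & `|z.2| <= 2 * c].
Proof.
move=> a0 c0 [/lteifW h1 h2]; have x0 : 0 < z.1 by have := sqr_ge0 a; nra.
have x2 : z.1 <= 2 * c by have := sqr_ge0 z.2; nra.
split=> //.
  by rewrite ler_pdivrMr ?mulr_gt0//; lra.
rewrite -(@ler_pXn2r _ 2) ?nnegrE ?normr_ge0 ?mulr_ge0 ?(ltW c0)//.
by rewrite real_normK ?num_real//; have := sqr_ge0 z.1; nra.
Qed.

Lemma truncated_disc_gt0 b c a z : 0 < a -> 0 < c -> truncated_disc b c a z -> 0 < z.1.
Proof.
by move=> a0 c0 [/lteifW h1 h2]; have := sqr_ge0 a; nra.
Qed.

(** With [y = x * t] both conditions become linear in [x > 0] after division by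
    [x], resp. extraction of a square root. *)
Lemma truncated_disc_slope b c a x t : 0 < a -> 0 < c ->
  truncated_disc b c a (x, x * t) <->
  x \in Interval (BRight (a / Num.sqrt (1 + t ^+ 2)))
                 (BSide (~~ b) (2 * c / (1 + t ^+ 2))).
Proof.
move=> a0 c0; have s0 : 0 < 1 + t ^+ 2 by have := sqr_ge0 t; lra.
have sqs0 : 0 < Num.sqrt (1 + t ^+ 2) by rewrite sqrtr_gt0.
have key : 0 < x -> (truncated_disc b c a (x, x * t) <->
    a / Num.sqrt (1 + t ^+ 2) < x /\ (x < 2 * c / (1 + t ^+ 2) ?<= if b)).
  move=> x0; rewrite /truncated_disc /=.
  rewrite (_ : x ^+ 2 + (x * t) ^+ 2 = x * (x * (1 + t ^+ 2))); last by ring.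
  rewrite [2 * c * x]mulrC lteif_pM2l// lteif_pdivlMr// ltr_pdivrMr//.
  have -> : (a ^+ 2 < x * (x * (1 + t ^+ 2))) = (a < x * Num.sqrt (1 + t ^+ 2)).
    rewrite -[RHS](@ltr_pXn2r _ 2) ?nnegrE ?mulr_ge0 ?(ltW a0) ?(ltW x0) ?(ltW sqs0)//.
    by rewrite exprMn sqr_sqrtr ?ltW// mulrA -expr2.
  by split=> -[].
rewrite itv_boundlr/=; split.
- move=> D; have x0 := truncated_disc_gt0 a0 c0 D.
  by move: D => /(key x0)[]; case: b {key} => /= h1 h2; rewrite !bnd_simp h1 h2.
- rewrite bnd_simp => /andP[h1 h2].
  have x0 : 0 < x by apply: lt_trans h1; rewrite divr_gt0.
  by apply/(key x0); split=> //; move: h2; case: b {key} => /=; rewrite bnd_simp.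
Qed.

(** Truncation keeps [x] at least [a ^+ 2 / (2 * c)], so slopes and density are
    bounded, on a set of finite area. *)
Lemma integrable_slope_density b k c a : 0 < a -> 0 < c ->
  area.-integrable (truncated_disc b c a) (EFin \o slope_density k).
Proof.
move=> a0 c0; set D := truncated_disc b c a.
have mD : measurable (D : set (measurableTypeR R * measurableTypeR R)).
  exact: measurable_truncated_disc.
have bD z : D z -> _ := @truncated_disc_bound b c a z a0 c0.
set m := a ^+ 2 / (2 * c) in bD.
have m0 : 0 < m by rewrite divr_gt0 ?exprn_gt0 ?mulr_gt0.
apply: measurable_bounded_integrable => //.
- apply: (@le_lt_trans _ _ (area (`[m, 2 * c] `*` `[- (2 * c), 2 * c]))).
    apply: le_measure; rewrite ?inE//.
      exact: measurableX.
    move=> z /bD[z1 z1' z2]; split; rewrite /= in_itv/=.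
      by rewrite z1.
    by rewrite -ler_norml.
  have -> : area (`[m, 2 * c] `*` `[- (2 * c), 2 * c]) =
      (@lebesgue_measure R `[m, (2 * c)%R] *
       @lebesgue_measure R `[(- (2 * c))%R, (2 * c)%R])%E.
    exact: product_measure1E.
  rewrite !lebesgue_measure_itv/=.
  by case: ifP => _; case: ifP => _; rewrite ?mule0 ?mul0e// -!EFinB -EFinM ltry.
- by apply: measurable_funTS; exact: measurable_slope_density.
- exists (1 + (2 * c / m) ^+ 2 + 4 * (2 * c / m) * (pi / 2) + `|k| / m ^+ 2).
  split; first exact: num_real.
  move=> M ltM z /bD[z1 z1x z2]; apply: le_trans (ltW ltM).
  have z10 : 0 < z.1 by exact: lt_le_trans z1.
  have t_le : `|z.2 / z.1| <= 2 * c / m.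
    rewrite normrM normfV (gtr0_norm z10) ler_pM ?invr_ge0 ?(ltW z10)//.
    by rewrite lef_pV2.
  rewrite /slope_density /slope_weight; set t := z.2 / z.1 in t_le *.
  have k_le : `|k / z.1 ^+ 2| <= `|k| / m ^+ 2.
    rewrite normrM normfV normrX (gtr0_norm z10) ler_wpM2l//.
    by rewrite lef_pV2 ?posrE ?exprn_gt0// ler_pXn2r ?nnegrE ?(ltW z10) ?(ltW m0).
  apply: (le_trans (ler_normD _ _)); rewrite lerD//.
  apply: (le_trans (ler_normB _ _)); rewrite lerD//.
    rewrite ger0_norm ?addr_ge0 ?sqr_ge0// lerD2l -(real_normK (num_real t)).
    by rewrite ler_pXn2r ?nnegrE ?normr_ge0 ?(le_trans _ t_le)//.
  rewrite normrM [`|4 * t|]normrM [`|4|]ger0_norm//.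
  rewrite ler_pM ?mulr_ge0 ?normr_ge0//; first by rewrite ler_wpM2l.
  by rewrite ler_norml (ltW (atan_gtNpi2 _)) (ltW (atan_ltpi2 _)).
Qed.

End TruncatedDisc.

(** * The energy of a truncated disc as an integral over slopes *)

Section DiscIntegral.
Context {R : realType}.
Implicit Types (b : bool) (a c k t x : R).

Local Notation mu := (@lebesgue_measure R).

(** The fundamental theorem of calculus with the primitive given through
    [is_derive], so that its derivative can be found by instance inference. *)
Lemma integral_is_derive (F f : R -> R) (p q : R) : p < q ->
  (forall x, x \in `[p, q] -> is_derive x 1 F (f x)) ->
  {in `[p, q], continuous f} ->
  (\int[mu]_(x in `[p, q]) (f x)%:E = (F q - F p)%:E)%E.
Proof.
move=> pq dF cf.
have cF x : x \in `[p, q] -> {for x, continuous F}.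
  move=> /dF dFx; apply/differentiable_continuous/derivable1_diffP.
  by case: dFx.
rewrite (@continuous_FTC2 _ f F)//.
- by apply: continuous_in_subspaceT => x /[!inE] xpq; exact: cf.
- split.
  + by move=> x /subset_itv_oo_cc/dF[].
  + by apply: cvg_at_right_filter; apply: cF; rewrite bound_itvE ltW.
  + by apply: cvg_at_left_filter; apply: cF; rewrite bound_itvE ltW.
- by move=> x /subset_itv_oo_cc/dF dFx; rewrite derive1E; case: dFx.
Qed.

(** The absolute slope of the two points where the circle of radius [c] centred at
    [(c, 0)] meets the circle of radius [a] about the origin. *)
Definition disc_slope c a : R := Num.sqrt ((2 * c / a) ^+ 2 - 1).

Lemma slice_nonempty c a t : 0 < a -> a < 2 * c ->
  (a / Num.sqrt (1 + t ^+ 2) < 2 * c / (1 + t ^+ 2)) =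
  (t \in `]- disc_slope c a, disc_slope c a[).
Proof.
move=> a0 ac; have s0 : 0 < 1 + t ^+ 2 by have := sqr_ge0 t; lra.
have sqs0 : 0 < Num.sqrt (1 + t ^+ 2) by rewrite sqrtr_gt0.
have c0 : 0 < 2 * c by exact: lt_trans ac.
rewrite in_itv/= -ltr_norml.
have T0 : 0 <= (2 * c / a) ^+ 2 - 1.
  by rewrite subr_ge0 exprn_ege1// ler_pdivlMr// mul1r ltW.
rewrite -[RHS](@ltr_pXn2r _ 2) ?nnegrE ?sqrtr_ge0//.
rewrite sqr_sqrtr// real_normK ?num_real// ltrBrDl expr_div_n.
rewrite !ltr_pdivlMr ?(exprn_gt0 _ a0)//.
have -> : a / Num.sqrt (1 + t ^+ 2) * (1 + t ^+ 2) = a * Num.sqrt (1 + t ^+ 2).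
  by rewrite -{2}(sqr_sqrtr (ltW s0)) expr2 mulrA divfK// gt_eqF.
rewrite -(@ltr_pXn2r _ 2) ?nnegrE ?(ltW c0) ?mulr_ge0 ?(ltW a0) ?(ltW sqs0)//.
by rewrite exprMn sqr_sqrtr ?(ltW s0)// mulrC.
Qed.

(** The part of [slice_energy] that has an elementary primitive. *)
Definition slice_main k c a t : R :=
  2 * c ^+ 2 * slope_weight t / (1 + t ^+ 2) ^+ 2 +
  k * (ln (2 * c / a) - ln (1 + t ^+ 2) / 2).

(** The values at the ends of the slice of the primitive
    [slope_weight t / 2 * x ^+ 2 + k * ln x], subtracted: the lower end
    [x = a / sqrt (1 + t ^+ 2)] yields the term in [a ^+ 2 / 2]. *)
Definition slice_energy k c a t : R :=
  slice_main k c a t - a ^+ 2 / 2 * (slope_weight t / (1 + t ^+ 2)).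

Lemma integral_slice b k c a t : 0 < a -> a < 2 * c ->
  (\int[mu]_(x in [set` Interval (BRight (a / Num.sqrt (1 + t ^+ 2))%R)
                               (BSide (~~ b) (2 * c / (1 + t ^+ 2))%R)])
    (x * slope_weight t + k / x)%:E =
  ((EFin \o slice_energy k c a) \_ `](- disc_slope c a)%R, disc_slope c a[) t)%E.
Proof.
move=> a0 ac; have s0 : 0 < 1 + t ^+ 2 by have := sqr_ge0 t; lra.
have sqs0 : 0 < Num.sqrt (1 + t ^+ 2) by rewrite sqrtr_gt0.
have c0 : 0 < 2 * c by exact: lt_trans ac.
have := @slice_nonempty c a t a0 ac.
set l := a / _; set u := _ / (1 + _) => lu.
have l0 : 0 < l by rewrite divr_gt0.
have u0 : 0 < u by rewrite divr_gt0.
rewrite patchE mem_setE -{}lu; case: ltP => lu; last first.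
  rewrite set_itv_ge ?integral_set0//; case: (b) => /=; rewrite bnd_simp -?leNgt//.
have mf : measurable_fun setT (fun x => (x * slope_weight t + k / x)%:E).
  apply/measurable_EFinP/measurable_funD; first exact: mulrr_measurable.
  by apply: measurable_funM => //; exact: measurable_invr.
rewrite integral_itv_bndoo; last exact: measurable_funTS.
rewrite -(@integral_itv_bndoo _ _ _ _ true false); last exact: measurable_funTS.
pose F x := slope_weight t / 2 * x ^+ 2 + k * ln x.
transitivity (F u - F l)%:E; last first.
  congr EFin; rewrite /F /slice_energy /slice_main /l /u.
  rewrite !ln_div ?posrE//.
  have -> : ln (1 + t ^+ 2) = 2 * ln (Num.sqrt (1 + t ^+ 2)).
    by rewrite -{1}(sqr_sqrtr (ltW s0)) lnXn// mulr_natl.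
  rewrite !expr_div_n sqr_sqrtr ?(ltW s0)//.
  by field; rewrite gt_eqF.
apply: (@integral_is_derive F (fun x => x * slope_weight t + k / x) l u lu).
- move=> x; rewrite in_itv/= => /andP[lx _].
  have x0 : 0 < x by exact: lt_le_trans lx.
  have dln := is_derive1_ln x0.
  rewrite /F; apply: is_derive_eq.
  by rewrite /GRing.scale/=; field; rewrite gt_eqF.
- move=> x; rewrite in_itv/= => /andP[lx _].
  have x0 : x != 0 by rewrite gt_eqF// (lt_le_trans l0).
  apply: cvgD; first by apply: cvgM; [exact: cvg_id|exact: cvg_cst].
  by apply: cvgM; [exact: cvg_cst|exact: inv_continuous].
Qed.

Lemma integral_truncated_disc b k c a : 0 < a -> a < 2 * c ->
  (\int[area]_(z in truncated_disc b c a) (slope_density k z)%:E =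
   \int[mu]_(t in `](- disc_slope c a)%R, disc_slope c a[) (slice_energy k c a t)%:E)%E.
Proof.
move=> a0 ac; have c0 : 0 < c by lra.
rewrite integral_mkcond integral_slope_iterated.
- rewrite [RHS]integral_mkcond; apply: eq_integral => t _.
  rewrite -(@integral_slice b)// [RHS]integral_mkcond.
  apply: eq_integral => x _; rewrite !patchE.
  have D := @truncated_disc_slope R b c a x t a0 c0.
  case: ifPn => [/set_mem h|h].
    have x0 : 0 < x := truncated_disc_gt0 a0 c0 h.
    rewrite ifT; last by rewrite mem_setE; apply/D.
    rewrite -EFinM; congr EFin; rewrite /slope_density/=.
    rewrite [x * t]mulrC mulfK ?gt_eqF//.
    by field; rewrite gt_eqF.
  rewrite ifF ?mule0//; apply/negbTE.
  by rewrite mem_setE; apply: contra h => /D/mem_set.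
- exact: (integrable_mkcond _ (@measurable_truncated_disc R b c a)).1
    (@integrable_slope_density R b k c a a0 c0).
- move=> z z0; rewrite patchE; case: ifPn => // /set_mem /(truncated_disc_gt0 a0 c0).
  by rewrite ltNge z0.
Qed.

End DiscIntegral.

(** * Energy of a truncated disc up to O(a) *)

Section Asymptotics.
Context {R : realType}.
Implicit Types (b : bool) (a c k t : R).

Local Notation mu := (@lebesgue_measure R).

Let oneDsqr_gt0 t : 0 < 1 + t ^+ 2.
Proof. by have := sqr_ge0 t; lra. Qed.

Let is_derive_oneDsqr t : is_derive t 1 (fun t : R => 1 + t ^+ 2) (2 * t).
Proof. by apply: is_derive_eq; rewrite /GRing.scale/=; ring. Qed.

Let is_derive_oneDsqrV t : is_derive t 1 (fun t : R => (1 + t ^+ 2)^-1)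
  (- (2 * t) / (1 + t ^+ 2) ^+ 2).
Proof.
have s0 : 1 + t ^+ 2 != 0 by rewrite gt_eqF.
have ds := is_derive_oneDsqr t.
apply: DeriveDef; first by apply: (@derivableV _ _ (fun t : R => 1 + t ^+ 2)).
rewrite (@deriveV _ _ (fun t : R => 1 + t ^+ 2))// derive_val /GRing.scale/=.
by field.
Qed.

Let is_derive_ln_oneDsqr t : is_derive t 1 (fun t : R => ln (1 + t ^+ 2))
  (2 * t / (1 + t ^+ 2)).
Proof.
have ds := is_derive_oneDsqr t; have dl := is_derive1_ln (oneDsqr_gt0 t).
apply: is_derive_eq.
by rewrite mulrC.
Qed.

Let is_derive_continuous (f : R -> R) t d : is_derive t 1 f d -> {for t, continuous f}.
Proof. by case=> df _; exact/differentiable_continuous/derivable1_diffP. Qed.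

(** The first term comes from [2 / s ^+ 2 - 4 * t * atan t / s ^+ 2] and
    [1 / s - 2 / s ^+ 2] being the derivatives of [2 * atan t / s] and [- t / s],
    with [s = 1 + t ^+ 2]; the second from integrating [ln s] by parts. *)
Definition slice_primitive k c a t : R :=
  2 * c ^+ 2 * ((2 * atan t - t) * (1 + t ^+ 2)^-1) +
  k * (t * (ln (2 * c / a) + 1) - 2^-1 * (t * ln (1 + t ^+ 2)) - atan t).

Let is_derive_slice_primitive k c a t :
  is_derive t 1 (slice_primitive k c a) (slice_main k c a t).
Proof.
have d1 := is_derive_oneDsqrV t; have d2 := is_derive_ln_oneDsqr t.
have d3 := @is_derive1_atan R t.
rewrite /slice_primitive; apply: is_derive_eq.
rewrite /slice_main /slope_weight /GRing.scale/=; field.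
by rewrite gt_eqF.
Qed.

Lemma continuous_slope_weight : continuous (@slope_weight R).
Proof.
move=> t; have d1 := is_derive_oneDsqr t; have d3 := @is_derive1_atan R t.
apply: (@is_derive_continuous _ t (2 * t - 4 * (atan t + t / (1 + t ^+ 2)))).
by rewrite /slope_weight; apply: is_derive_eq; rewrite /GRing.scale/=; ring.
Qed.

Let continuous_oneDsqrV : continuous (fun t : R => (1 + t ^+ 2)^-1).
Proof. by move=> t; exact: is_derive_continuous (is_derive_oneDsqrV t). Qed.

Let continuous_slice_main k c a : continuous (slice_main k c a).
Proof.
move=> t; rewrite /slice_main; apply: cvgD.
  apply: cvgM; first by apply: cvgM; [exact: cvg_cst|exact: continuous_slope_weight].
  apply: cvgV; first by rewrite gt_eqF// exprn_gt0.
  apply: (@continuous_comp _ _ _ (fun t : R => 1 + t ^+ 2) (fun x : R => x ^+ 2)).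
    exact: is_derive_continuous (is_derive_oneDsqr t).
  exact: exprn_continuous.
apply: cvgM; first exact: cvg_cst.
apply: cvgB; first exact: cvg_cst.
apply: cvgM; last exact: cvg_cst.
exact: is_derive_continuous (is_derive_ln_oneDsqr t).
Qed.

Let continuous_rem : continuous (fun t : R => slope_weight t / (1 + t ^+ 2)).
Proof.
by move=> t; apply: cvgM; [exact: continuous_slope_weight|exact: continuous_oneDsqrV].
Qed.

(** Since [2 * `|t| <= 1 + t ^+ 2] and [`|atan t| <= pi / 2]. *)
Lemma slope_weight_bound t : `|slope_weight t / (1 + t ^+ 2)| <= 1 + pi.
Proof.
have s0 := oneDsqr_gt0 t.
rewrite normrM normfV (gtr0_norm s0) ler_pdivrMr// /slope_weight.
apply: (le_trans (ler_normB _ _)); rewrite (gtr0_norm s0).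
have p0 := @pi_gt0 R.
have at_le : `|atan t| <= pi / 2.
  by rewrite ler_norml (ltW (atan_gtNpi2 _)) (ltW (atan_ltpi2 _)).
have t_le : 2 * `|t| <= 1 + t ^+ 2.
  by rewrite -(real_normK (num_real t)); have := sqr_ge0 (`|t| - 1); nra.
have -> : `|4 * t * atan t| = 4 * `|t| * `|atan t| by rewrite !normrM ger0_norm.
have A0 := normr_ge0 t; have B0 := normr_ge0 (atan t).
have h1 : 0 <= `|atan t| * (1 + t ^+ 2 - 2 * `|t|) by rewrite mulr_ge0// subr_ge0.
have h2 : 0 <= (1 + t ^+ 2) * (pi / 2 - `|atan t|).
  by rewrite mulr_ge0 ?(ltW s0)// subr_ge0.
nra.
Qed.

Lemma disc_slopeE c a : 0 < a -> a < 2 * c ->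
  1 + disc_slope c a ^+ 2 = (2 * c / a) ^+ 2.
Proof.
move=> a0 ac; rewrite sqr_sqrtr; first by ring.
by rewrite subr_ge0 exprn_ege1// ler_pdivlMr// mul1r ltW.
Qed.

Lemma disc_slope_gt0 c a : 0 < a -> a < 2 * c -> 0 < disc_slope c a.
Proof.
move=> a0 ac; rewrite sqrtr_gt0 subr_gt0 exprn_egt1//.
by rewrite ltr_pdivlMr// mul1r.
Qed.

(** At [t = T] the logarithms cancel, because [1 + T ^+ 2 = (2 * c / a) ^+ 2], and
    the factor [c ^+ 2] is traded for [a ^+ 2]. *)
Lemma slice_primitive_disc_slope k c a : 0 < a -> a < 2 * c ->
  let T := disc_slope c a in
  slice_primitive k c a T - slice_primitive k c a (- T) =
  a ^+ 2 * (2 * atan T - T) + 2 * k * (T - atan T).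
Proof.
move=> a0 ac T; have c0 : 0 < c by lra.
have sE := disc_slopeE a0 ac.
rewrite /slice_primitive sqrrN -/T sE atanN lnXn ?divr_gt0//; last by lra.
rewrite -mulr_natl.
by field; rewrite !gt_eqF.
Qed.

(** The error collects [a ^+ 2 * (2 * atan T - T)] and the integral of the bounded
    remainder over an interval of length [2 * T]; both are [O(a)] because
    [T <= 2 * c / a]. *)
Lemma disc_energy_bound b k c a : 0 < a -> a < 2 * c ->
  `|\int[area]_(z in truncated_disc b c a) slope_density k z
    - 2 * k * (disc_slope c a - atan (disc_slope c a))|
  <= a ^+ 2 * (pi + (2 + pi) * disc_slope c a).
Proof.
move=> a0 ac; set T := disc_slope c a.
have T0 : 0 < T := disc_slope_gt0 a0 ac.
have int_cont (f : R -> R) : continuous f -> mu.-integrable `[- T, T] (EFin \o f).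
  move=> cf; apply: continuous_compact_integrable; first exact: segment_compact.
  exact: continuous_subspaceT.
pose g t : R := slope_weight t / (1 + t ^+ 2).
have ig : mu.-integrable `[- T, T] (EFin \o g) by exact: int_cont continuous_rem.
have im := int_cont _ (@continuous_slice_main k c a).
have -> : \int[area]_(z in truncated_disc b c a) slope_density k z =
    (a ^+ 2 * (2 * atan T - T) + 2 * k * (T - atan T)) -
    a ^+ 2 / 2 * \int[mu]_(t in `[- T, T]) g t.
  rewrite {1}/Rintegral integral_truncated_disc// -/T.
  rewrite -(@integral_itv_bndoo _ _ _ _ true false); last first.
    apply/measurable_funTS/measurable_EFinP; apply: continuous_measurable_fun.
    move=> t; apply: cvgB; first exact: continuous_slice_main.
    by apply: cvgM; [exact: cvg_cst|exact: continuous_rem].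
  rewrite -/(Rintegral _ _ _) RintegralB//; last first.
    by apply: int_cont => t; apply: cvgM; [exact: cvg_cst|exact: continuous_rem].
  rewrite RintegralZl//; congr (_ - _).
  rewrite -slice_primitive_disc_slope// -/T /Rintegral.
  have NT : - T < T by lra.
  suff -> : (\int[mu]_(t in `[(- T)%R, T]) (slice_main k c a t)%:E =
      (slice_primitive k c a T - slice_primitive k c a (- T))%:E)%E by [].
  exact: (@integral_is_derive R (slice_primitive k c a) (slice_main k c a) _ _ NT).
have int_le : `|\int[mu]_(t in `[- T, T]) g t| <= (1 + pi) * (2 * T).
  apply: le_trans (le_normr_Rintegral _ ig) _ => //.
  apply: (@le_trans _ _ (\int[mu]_(t in `[- T, T]) (cst (1 + pi) t))).
    apply: le_Rintegral => //; first exact: integrable_norm.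
      by apply: int_cont => t; exact: cvg_cst.
    by move=> t _; exact: slope_weight_bound.
  rewrite Rintegral_cst//= lebesgue_measure_itv/= lte_fin.
  by rewrite ifT; [rewrite -EFinB/=; lra|lra].
have at_le : 0 <= atan T <= pi / 2.
  by rewrite (ltW (atan_ltpi2 _)) andbT -atan0 le_atan// ltW.
move: int_le; set I := (X in `|X| <= _) => int_le.
have p0 := @pi_gt0 R.
have -> : a ^+ 2 * (2 * atan T - T) + 2 * k * (T - atan T) - a ^+ 2 / 2 * I -
    2 * k * (T - atan T) = a ^+ 2 * ((2 * atan T - T) - I / 2) by field.
rewrite normrM ger0_norm ?sqr_ge0// ler_wpM2l ?sqr_ge0//.
move: int_le; rewrite !ler_norml => /andP[? ?]; case/andP: at_le => ? ?.
by apply/andP; split; nra.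
Qed.

(** With [u = 2 * c / a], [(u - T) * (u + T) = 1]. *)
Lemma disc_slope_bound c a : 0 < a -> a < 2 * c ->
  0 <= 2 * c / a - disc_slope c a <= a / (2 * c).
Proof.
move=> a0 ac; have T0 := disc_slope_gt0 a0 ac; have sE := disc_slopeE a0 ac.
have u0 : 0 < 2 * c / a by rewrite divr_gt0//; lra.
have -> : a / (2 * c) = (2 * c / a)^-1 by rewrite invf_div.
set u := 2 * c / a in sE u0 *; set T := disc_slope c a in sE T0 *.
have d0 : 0 <= u - T by nra.
rewrite d0/= -[leRHS]mul1r ler_pdivlMr//.
nra.
Qed.

End Asymptotics.

(** * Passage to the limit *)

Section Limits.
Context {R : realType}.
Implicit Types (b : bool) (a c k : R).

Lemma cvg_disc_slope c : 0 < c -> disc_slope c a @[a --> 0^'+] --> +oo.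
Proof.
move=> c0; apply/cvgryPge => A; near=> a.
have a0 : 0 < a by near: a; exact: nbhs_right_gt.
have ac : a < 2 * c by near: a; apply: nbhs_right_lt; lra.
have aA : a < 2 * c / (`|A| + 1).
  by near: a; apply: nbhs_right_lt; rewrite divr_gt0 ?mulr_gt0// ltr_wpDl.
have /andP[_] := disc_slope_bound a0 ac.
have h1 : a / (2 * c) <= 1 by rewrite ler_pdivrMr ?mulr_gt0// mul1r ltW.
have h2 : `|A| + 1 <= 2 * c / a.
  move: aA; rewrite ltr_pdivlMr ?ltr_wpDl// => aA.
  by rewrite ler_pdivlMr// mulrC ltW.
by have := ler_norm A; lra.
Unshelve. all: by end_near. Qed.

(** The divergent part is linear in [c] and the limit is the same for all [c]. *)
Lemma cvg_disc_energy b k c : 0 < c ->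
  \int[area]_(z in truncated_disc b c a) slope_density k z - 4 * k * c / a
    @[a --> 0^'+] --> - (k * pi).
Proof.
move=> c0.
have a_cvg : a @[a --> 0^'+] --> (0 : R) by exact: cvg_at_right_filter.
have c1 : \int[area]_(z in truncated_disc b c a) slope_density k z
    - 2 * k * (disc_slope c a - atan (disc_slope c a)) @[a --> 0^'+] --> (0 : R).
  apply/norm_cvg0P.
  apply: (@squeeze_cvgr _ _ _ _ (fun=> 0)
    (fun a : R => a * (pi * a + (2 + pi) * (2 * c)))).
  - near=> a; rewrite normr_ge0/=.
    have a0 : 0 < a by near: a; exact: nbhs_right_gt.
    have ac : a < 2 * c by near: a; apply: nbhs_right_lt; lra.
    apply: le_trans (disc_energy_bound b k a0 ac) _.
    have p0 := @pi_gt0 R.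
    have aT : a * disc_slope c a <= 2 * c.
      have /andP[h _] := disc_slope_bound a0 ac.
      by rewrite mulrC -ler_pdivlMr// -subr_ge0.
    rewrite expr2 -mulrA ler_pM2l//.
    rewrite mulrDr mulrC lerD2l mulrCA ler_wpM2l//; lra.
  - exact: cvg_cst.
  - rewrite -[X in _ --> X](mul0r (pi * 0 + (2 + pi) * (2 * c))).
    apply: cvgM => //; apply: cvgD; last exact: cvg_cst.
    by apply: cvgM => //; exact: cvg_cst.
have c2 : 2 * c / a - disc_slope c a @[a --> 0^'+] --> (0 : R).
  apply: (@squeeze_cvgr _ _ _ _ (fun=> 0) (fun a : R => a / (2 * c))).
  - near=> a; apply: disc_slope_bound.
      by near: a; exact: nbhs_right_gt.
    by near: a; apply: nbhs_right_lt; lra.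
  - exact: cvg_cst.
  - by rewrite -[X in _ --> X](mul0r (2 * c)^-1); apply: cvgM => //; exact: cvg_cst.
have c3 : atan (disc_slope c a) @[a --> 0^'+] --> pi / 2.
  exact: cvg_comp (cvg_disc_slope c0) (@cvgy_atan R).
rewrite (_ : - (k * pi) = 0 - 2 * k * 0 - 2 * k * (pi / 2)); last by field.
rewrite (_ : (fun a => _) = fun a =>
  (\int[area]_(z in truncated_disc b c a) slope_density k z
    - 2 * k * (disc_slope c a - atan (disc_slope c a)))
  - 2 * k * (2 * c / a - disc_slope c a) - 2 * k * atan (disc_slope c a)).
  apply: cvgB; first apply: cvgB => //.
    by apply: cvgM => //; exact: cvg_cst.
  by apply: cvgM => //; exact: cvg_cst.
by apply/funext => a; ring.
Unshelve. all: by end_near. Qed.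

Section Region.
Variables (k c2 c1 : R).
Hypotheses (c20 : 0 < c2) (c21 : c2 < c1).

Let c10 : 0 < c1. Proof. exact: lt_trans c21. Qed.

Lemma Omega_a_sub a : 0 <= a -> Omega_a c2 c1 a `<=` truncated_disc true c1 a.
Proof. by move=> a0; rewrite -(Omega_a_setU a0 c20 c21); exact: subsetUl. Qed.

Lemma energy_density_Omega_a a : 0 < a ->
  {in Omega_a c2 c1 a, energy_density k =1 slope_density k}.
Proof.
move=> a0 z /set_mem/(Omega_a_sub (ltW a0)) Dz.
exact: energy_densityE (truncated_disc_gt0 a0 c10 Dz).
Qed.

Lemma integrable_energy_density a : 0 < a ->
  area.-integrable (Omega_a c2 c1 a) (EFin \o energy_density k).
Proof.
move=> a0; have a0' := ltW a0.
apply: (@eq_integrable _ _ _ area _ (@measurable_Omega_a R c2 c1 a a0' c20 c21)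
  (EFin \o slope_density k)).
  by move=> z /(energy_density_Omega_a a0) /= ->.
exact: (integrableS (@measurable_truncated_disc R true c1 a)
  (@measurable_Omega_a R c2 c1 a a0' c20 c21) (Omega_a_sub a0')
  (@integrable_slope_density R true k c1 a a0 c10)).
Qed.

Lemma strain_energyE a : 0 < a ->
  strain_energy k c2 c1 a =
  2^-1 * (\int[area]_(z in truncated_disc true c1 a) slope_density k z -
          \int[area]_(z in truncated_disc false c2 a) slope_density k z).
Proof.
move=> a0; have a0' := ltW a0; rewrite /strain_energy; congr (_ * _).
rewrite -(Omega_a_setU a0' c20 c21) Rintegral_setU.
- rewrite addrK; apply: eq_Rintegral => z; exact: energy_density_Omega_a.
- exact: (@measurable_Omega_a R c2 c1 a a0' c20 c21).
- exact: (@measurable_truncated_disc R false c2 a).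
- by rewrite Omega_a_setU//; exact: (@integrable_slope_density R true k c1 a a0 c10).
- exact: Omega_a_disj.
Qed.

Lemma cvg_strain_energy :
  strain_energy k c2 c1 a - 2 * k / a * (c1 - c2) @[a --> 0^'+] --> (0 : R).
Proof.
pose J b c a := \int[area]_(z in truncated_disc b c a) slope_density k z.
have h : 2^-1 * ((J true c1 a - 4 * k * c1 / a) - (J false c2 a - 4 * k * c2 / a))
    @[a --> 0^'+] --> 2^-1 * (- (k * pi) - - (k * pi)).
  by apply: cvgM; [exact: cvg_cst|apply: cvgB; exact: cvg_disc_energy].
rewrite subrr mulr0 in h; apply: cvg_trans h; apply: near_eq_cvg; near=> a.
have a0 : 0 < a by near: a; exact: nbhs_right_gt.
rewrite strain_energyE// -/(J true c1 a) -/(J false c2 a).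
by field; rewrite gt_eqF.
Unshelve. all: by end_near. Qed.

Lemma strain_energy_bigO :
  strain_energy k c2 c1 =O_ (0^'+) (fun a : R => a^-1).
Proof.
apply/eqOP; near=> M; near=> a.
have a0 : 0 < a by near: a; exact: nbhs_right_gt.
have a1 : a < 1 by near: a; exact: nbhs_right_lt.
have M0 : 1 + `|2 * k * (c1 - c2)| <= M by near: M; exact: nbhs_pinfty_ge.
have h : `|strain_energy k c2 c1 a - 2 * k / a * (c1 - c2)| <= 1.
  by near: a; apply: (cvgr0_norm_le _ cvg_strain_energy).
rewrite -[X in `|X|](subrK (2 * k / a * (c1 - c2))).
apply: le_trans (ler_normD _ _) _.
rewrite [`|a^-1|]ger0_norm ?invr_ge0 ?(ltW a0)//.
apply: (@le_trans _ _ ((1 + `|2 * k * (c1 - c2)|) / a)); last first.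
  by rewrite ler_wpM2r// invr_ge0 ltW.
rewrite [leRHS]mulrDl lerD//.
  by rewrite (le_trans h)// mul1r invf_ge1// ltW.
by rewrite mulrAC normrM normfV (gtr0_norm a0).
Unshelve. all: by end_near. Qed.

Lemma cvg_strain_energy_k0 : k = 0 ->
  strain_energy k c2 c1 a @[a --> 0^'+] --> (0 : R).
Proof.
move=> k0; have := cvg_strain_energy; rewrite k0.
by under eq_fun do rewrite mulr0 !mul0r subr0.
Qed.

End Region.
End Limits.

Theorem mainTheorem5 (R : realType) (rho k : R) (hrho : 1 < rho)
    (hk : 0 <= k) :
  (forall c2 c1 : R, 1 <= c2 -> c2 < c1 -> c1 <= rho ->
    [/\ \forall a \near 0^'+,
          area.-integrable (Omega_a c2 c1 a) (EFin \o energy_density k),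
        `|strain_energy k c2 c1 a - 2 * k / a * (c1 - c2)| @[a --> 0^'+] --> 0,
        strain_energy k c2 c1 =O_ (0^'+) (fun a : R => a^-1)
      & k = 0 -> strain_energy k c2 c1 a @[a --> 0^'+] --> 0]) /\
  `|strain_energy k 1 rho a - 2 * k / a * (rho - 1)| @[a --> 0^'+] --> 0 /\
  (k = 0 -> strain_energy k 1 rho a @[a --> 0^'+] --> 0).
Proof.
have norm_cvg c2 c1 : 0 < c2 -> c2 < c1 ->
    `|strain_energy k c2 c1 a - 2 * k / a * (c1 - c2)| @[a --> 0^'+] --> 0.
  by move=> c20 c21; apply/norm_cvg0P; exact: cvg_strain_energy.
split; last by split; [exact: norm_cvg|exact: cvg_strain_energy_k0].
move=> c2 c1 c2_ge1 c21 _; have c20 : 0 < c2 by exact: lt_le_trans c2_ge1.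
split.
- near=> a; have a0 : 0 < a by near: a; exact: nbhs_right_gt.
  exact: integrable_energy_density.
- exact: norm_cvg.
- exact: strain_energy_bigO.
- exact: cvg_strain_energy_k0.
Unshelve. all: by end_near. Qed.
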